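(* Let $\mu=\mu_a+\mu_s$ be a finite Borel measure on $[0,1)$ such that $\mu_s$ is singular and $\mu_a$ is absolutely continuous with Radon-Nikodym derivative $g$ bounded above and below on its support, where the support of $g$ contains an interval $(c,d)$. Suppose there exists a Borel set $B$ of Lebesgue measure zero with $\mu(B)>0$ such that $$B\subseteq[a,b]\subseteq(c,d)\subseteq\{x:g(x)>0\}$$ for some $a$ and $b$. Then there is no $\{c_n\}_{n=-\infty}^{\infty}\in\ell^2(\mathbb{Z})$ such that $$\sum_n c_ne^{2\pi i n x}=\chi_B$$ with convergence in $L^2(\mu)$.
   Context: Measures are positive; ''absolutely continuous'' and ''singular'' are with respect to Lebesgue measure. The support of $g$ is $\{x:g(x)>0\}$; $g$ bounded above and below on its support means there are constants $0<m\le M<\infty$ with $m\le g\le M$ almost everywhere on $\{g>0\}$. Sums over $\mathbb Z$ are limits of the symmetric partial sums $\sum_{n=-M}^{M}$ as $M\to\infty$. $\chi_B$ is the characteristic function of $B$. *)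

(* Defs.v *)
From mathcomp Require Import all_boot all_order all_algebra.
From mathcomp Require Import all_classical all_reals all_analysis.
From mathcomp Require Import complex.

Set Implicit Arguments.
Unset Strict Implicit.
Unset Printing Implicit Defensive.

Import Order.TTheory GRing.Theory Num.Theory.
Import numFieldNormedType.Exports.

Local Open Scope classical_set_scope.
Local Open Scope ring_scope.
Local Open Scope complex_scope.

(* A Borel measure on [0, 1) is represented as a Borel measure on the line
   giving no mass to the complement of [0, 1). *)
Definition carried_by_unit (R : realType)
    (mu : set (measurableTypeR R) -> \bar R) : Prop :=
  mu (~` `[0, 1[) = 0%E.

Definition mutually_singular (d : measure_display) (T : measurableType d)
    (R : realType) (mu nu : set T -> \bar R) : Prop :=
  exists N : set T, [/\ measurable N, mu N = 0%E & nu (~` N) = 0%E].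

(* [g] is only meaningful on [0, 1): its values elsewhere are never used.
   Being a pointwise function, it is a chosen representative of the
   Radon-Nikodym derivative, as the hypothesis (c, d) \subset {g > 0} needs. *)
Definition is_RN_derivative (R : realType)
    (nu : set (measurableTypeR R) -> \bar R) (g : R -> R) : Prop :=
  [/\ measurable_fun (`[0, 1[ : set (measurableTypeR R)) g,
      (forall x : R, x \in `[0, 1[ -> 0 <= g x) &
      (forall A : set (measurableTypeR R), measurable A -> A `<=` `[0, 1[ ->
        nu A = (\int[@lebesgue_measure R]_(x in A) (g x)%:E)%E)].

Definition pos_support (R : realType) (g : R -> R) : set R :=
  [set x | (x \in `[0, 1[) && (0 < g x)].

Definition bounded_on_support (R : realType) (g : R -> R) : Prop :=
  exists m M : R, [/\ 0 < m, m <= M &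
    {ae @lebesgue_measure R, forall x : R, pos_support g x -> m <= g x <= M}].

Definition square_summable (R : realType) (c : int -> R[i]) : Prop :=
  summable [set: int] (fun n : int => (Normc.normc (c n) ^+ 2)%:E).

(* e^(2 pi i n x) *)
Definition fourier_exp (R : realType) (n : int) (x : R) : R[i] :=
  cos (2 * pi * n%:~R * x) +i* sin (2 * pi * n%:~R * x).

(* The index n = k - M runs over -M, ..., M. *)
Definition fourier_partial_sum (R : realType) (c : int -> R[i]) (M : nat)
    (x : R) : R[i] :=
  \sum_(k < (2 * M).+1) c (k%:Z - M%:Z) * fourier_exp (k%:Z - M%:Z) x.

(* Stated with the extended-real norm of the difference, so that [f] itself is
   not assumed to lie in L^2(mu). *)
Definition cvg_L2 (R : realType)
    (mu : {measure set (measurableTypeR R) -> \bar R})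
    (u : nat -> R -> R[i]) (f : R -> R[i]) : Prop :=
  Lnorm mu 2%:E (fun x : R => (Normc.normc (u M x - f x))%:E) @[M --> \oo]
    --> 0%E.

(* Main.v *)
Require Import Defs.
From mathcomp Require Import all_boot all_order all_algebra.
From mathcomp Require Import all_classical all_reals all_analysis.
From mathcomp Require Import complex measurable_realfun.
From mathcomp Require Import ring lra zify.
Import Order.TTheory GRing.Theory Num.Theory.
Import numFieldNormedType.Exports.
Local Open Scope classical_set_scope.
Local Open Scope ring_scope.
Local Open Scope complex_scope.

(* Let S_N be the symmetric partial sums.  Since B is Lebesgue-null and mu
   dominates a multiple of Lebesgue measure on (c, d), convergence to 1_B in
   L^2(mu) forces S_N -> 0 in L^2(c, d).  Riemann localization then gives
   S_k -> 0 uniformly on [a, b], which contains B; but S_k -> 1 in L^2(mu) on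
   B, so mu(B) = 0.

   Localization is proved for real trigonometric sums T_N, the real parts of
   the S_N, without Fourier integrals.  For N >= k, the integral of
   T_N(y) D_k(y - x) over [x - d, x + d], with D_k the Dirichlet kernel, equals
   T_k(x) up to an error whose n-th coefficient has weight O(1 / (1 + |n - k|)).
   Letting N tend to infinity kills the integral, and the error tends to 0 with
   k, uniformly in x, because the coefficients are square summable. *)

Set Implicit Arguments.
Unset Strict Implicit.
Unset Printing Implicit Defensive.

(** * The Dirichlet kernel and the sawtooth series *)

(* The remainder of the Fourier series of [1/2 - t]; on (0, 1/2] it is the
   integral of [dirichlet k] over [t, 1/2]. *)
Definition sawtooth_rem (R : realType) (k : nat) (t : R) : R :=
  2^-1 - t - \sum_(j < k) sin (2 * pi * j.+1%:R * t) / (pi * j.+1%:R).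

Definition dirichlet (R : realType) (k : nat) (t : R) : R :=
  1 + \sum_(j < k) 2 * cos (2 * pi * j.+1%:R * t).

Lemma is_derive_sin_scale (R : realType) (w t : R) :
  is_derive t 1 (fun u => sin (w * u)) (w * cos (w * t)).
Proof.
by apply: is_derive_eq; rewrite /GRing.scale /= mulr1 mulrC.
Qed.

Lemma is_derive_cos_scale (R : realType) (w t : R) :
  is_derive t 1 (fun u => cos (w * u)) (- (w * sin (w * t))).
Proof.
by apply: is_derive_eq; rewrite /GRing.scale /= mulr1; ring.
Qed.

Lemma is_derive_sawtooth_rem (R : realType) (k : nat) (t : R) :
  is_derive t 1 (sawtooth_rem k) (- dirichlet k t).
Proof.
rewrite /sawtooth_rem /dirichlet.
elim: k => [|k IH].
  rewrite (_ : (fun _ => _) = (fun u : R => 2^-1 - u)); last first.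
    by apply/funext => u; rewrite big_ord0 subr0.
  rewrite big_ord0; apply: is_derive_eq; lra.
rewrite (_ : (fun _ => _) = (fun u : R => (2^-1 - u -
   \sum_(j < k) sin (2 * pi * j.+1%:R * u) / (pi * j.+1%:R)) -
   sin (2 * pi * k.+1%:R * u) * (pi * k.+1%:R)^-1)); last first.
  by apply/funext => u; rewrite big_ord_recr /= opprD addrA.
rewrite big_ord_recr /=.
have h := is_derive_sin_scale (2 * pi * k.+1%:R) t.
have pk : pi * k.+1%:R != 0 :> R by rewrite mulf_neq0 ?gt_eqF ?pi_gt0.
apply: is_derive_eq.
rewrite /GRing.scale /=.
have p0 : pi != 0 :> R by rewrite gt_eqF ?pi_gt0.
have k0 : 1 + k%:R != 0 :> R by rewrite addrC natr1 pnatr_eq0.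
clear pk h; move: (@pi R) p0 => P p0.
by field; rewrite k0.
Qed.

(** Telescoping: [2 cos(2 pi j t) sin(pi t)] is the sine of [(2 j + 1) pi t] minus the sine of
    [(2 j - 1) pi t]. *)
Lemma dirichletM_sin (R : realType) (k : nat) (t : R) :
  dirichlet k t * sin (pi * t) = sin (pi * (2 * k + 1)%:R * t).
Proof.
rewrite /dirichlet; elim: k => [|k IH].
  by rewrite big_ord0 addr0 mul1r mulr1.
rewrite big_ord_recr /= addrA mulrDl IH.
have -> : pi * (2 * k + 1)%:R * t = 2 * pi * k.+1%:R * t - pi * t.
  rewrite -natr1 natrD natrM; ring.
have -> : pi * (2 * k.+1 + 1)%:R * t = 2 * pi * k.+1%:R * t + pi * t.
  rewrite -natr1 natrD natrM -natr1; ring.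
rewrite sinB sinD; ring.
Qed.

Lemma sinpiM_nat (R : realType) (k : nat) : sin (pi * k%:R) = 0 :> R.
Proof.
elim: k => [|k IH]; first by rewrite mulr0 sin0.
by rewrite -natr1 mulrDr mulr1 sinDpi IH oppr0.
Qed.

Lemma sawtooth_rem_half (R : realType) (k : nat) : sawtooth_rem k (2^-1 : R) = 0.
Proof.
rewrite /sawtooth_rem subrr sub0r big1 ?oppr0// => j _.
rewrite (_ : _ * 2^-1 = pi * j.+1%:R); last by move: (@pi R) => P; field.
by rewrite sinpiM_nat mul0r.
Qed.

Lemma cos_odd_half (R : realType) (k : nat) :
  cos (pi * (2 * k + 1)%:R * 2^-1) = 0 :> R.
Proof.
rewrite (_ : _ * 2^-1 = pi * k%:R + pi / 2); last first.
  by rewrite natrD natrM; move: (@pi R) => P; field.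
by rewrite cosDpihalf sinpiM_nat oppr0.
Qed.

(* Integration by parts on [d, 1/2]: once the boundary term is included in [Q],
   the derivative of [Q] is O(1 / k). *)
Lemma sawtooth_rem_bound (R : realType) (d : R) : 0 < d <= 2^-1 ->
  exists2 C : R, 0 < C & forall k, `|sawtooth_rem k d| <= C / k.+1%:R.
Proof.
move=> /andP[d0 d2].
have pi0 : 0 < pi :> R := pi_gt0 R.
have pi2 : 2 <= pi :> R := pi_ge2 R.
have pid (x : R) : 0 < x -> 0 < pi * x by move=> x0; exact: mulr_gt0.
(* Since [sin (pi t)] increases on [0, 1/2], the denominators on [d, 1/2] stay above
   [sin (pi d)]. *)
have sin_mono x : d <= x <= 2^-1 -> sin (pi * d) <= sin (pi * x).
  move=> /andP[dx x2].
  have [->//|ndx] := eqVneq d x.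
  have {}dx : d < x by rewrite lt_neqAle ndx.
  have [h1 h2] := (pid _ d0, pid _ (lt_trans d0 dx)).
  have h3 : pi * x <= pi / 2 by rewrite ler_pM2l.
  have h4 : pi * d <= pi / 2 by rewrite ler_pM2l.
  have h5 : 0 < pi / 2 :> R by exact: lt_le_trans h3.
  apply: ltW; rewrite ltr_sin ?ltr_pM2l// in_itv /= ?h3 ?h4 andbT.
    by rewrite (le_trans _ (ltW h1))// oppr_le0 ltW.
  by rewrite (le_trans _ (ltW h2))// oppr_le0 ltW.
have s0 : 0 < sin (pi * d).
  apply: sin_gt0_pi; rewrite pid//= -[ltRHS]mulr1 ltr_pM2l//.
  by apply: (le_lt_trans d2); lra.
set s := sin (pi * d) in sin_mono s0 *.
have s1 : s <= 1 by exact: sin_le1.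
(* The bounds [b1] and [b2] below contribute [1 / (n s^2)] each, and [n = 2 k + 1] is at least
   [k + 1]. *)
exists (2 / s ^+ 2); first by rewrite divr_gt0 ?exprn_gt0.
move=> k.
pose n : R := (2 * k + 1)%:R.
have n0 : 0 < n by rewrite ltr0n addn1.
pose Q t := sawtooth_rem k t - cos (pi * n * t) * (pi * n * sin (pi * t))^-1.
pose dQ t := cos (pi * n * t) * cos (pi * t) / (n * sin (pi * t) ^+ 2).
have Qd x : x \in `[d, 2^-1] -> is_derive x 1 Q (dQ x).
  rewrite in_itv /= => /[dup] xd /sin_mono sx.
  have sx0 : sin (pi * x) != 0 by rewrite gt_eqF // (lt_le_trans s0).
  have h1 := is_derive_sawtooth_rem k x.
  have h2 := is_derive_cos_scale (pi * n) x.
  have h3 := is_derive_sin_scale pi x.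
  have h4 : pi * n * sin (pi * x) != 0.
    by rewrite !mulf_neq0// gt_eqF.
  have h5 : is_derive x 1 (fun t => (pi * n * sin (pi * t))^-1)
     (- (pi * n * sin (pi * x)) ^- 2 * (pi * n * (pi * cos (pi * x)))).
    have h6 : is_derive x 1 (fun t => pi * n * sin (pi * t))
        (pi * n * (pi * cos (pi * x))).
      by apply: is_derive_eq; rewrite /GRing.scale /= ?scaler0 ?addr0; ring.
    by apply: is_derive_eq.
  apply: is_derive_eq.
  rewrite /dQ /GRing.scale /=.
  (* The quotient form of [dirichlet k x] cancels the term that comes from differentiating the
     cosine in [Q]. *)
  have := dirichletM_sin k x; rewrite -/n => hD.
  have -> : dirichlet k x = sin (pi * n * x) / sin (pi * x).
    by rewrite -hD mulfK.
  move: (sin (pi * x)) sx0 (gt_eqF pi0) => S S0 /negbT.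
  move: (@pi R) => P P0; field.
  by rewrite S0 P0 gt_eqF.
have Qc : {within `[d, 2^-1], continuous Q}.
  apply: derivable_within_continuous => x xd.
  by case: (Qd _ xd).
have Qd' u : u \in `]d, 2^-1[ -> is_derive u 1 Q (dQ u).
  by move=> ud; apply: Qd; exact: subset_itv_oo_cc ud.
have [x xd hQ] := @MVT_segment R Q dQ d 2^-1 d2 Qd' Qc.
(* The remainder and the boundary term both vanish at 1/2, so the mean value theorem determines
   [Q d]. *)
have Q0 : Q 2^-1 = 0.
  have h0 := sawtooth_rem_half R k.
  have h1 : cos (pi * n * 2^-1) = 0 by exact: cos_odd_half.
  have -> : Q 2^-1 = sawtooth_rem k (2^-1 : R) -
      cos (pi * n * 2^-1) * (pi * n * sin (pi * 2^-1))^-1 by [].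
  by rewrite h0 h1 mul0r subrr.
have QdE : Q d = sawtooth_rem k d - cos (pi * n * d) * (pi * n * s)^-1 by [].
have Qz : 0 - Q d = dQ x * (2^-1 - d) by rewrite -hQ Q0.
have -> : sawtooth_rem k d =
    cos (pi * n * d) * (pi * n * s)^-1 - dQ x * (2^-1 - d).
  by rewrite -Qz QdE sub0r opprK addrC subrK.
have hs : s <= sin (pi * x) by apply: sin_mono; move: xd; rewrite in_itv.
have b1 : `|cos (pi * n * d) * (pi * n * s)^-1| <= (n * s ^+ 2)^-1.
  rewrite normrM (le_trans (ler_pM _ _ (cos_max _) (lexx _)))// mul1r.
  rewrite normfV gtr0_norm ?mulr_gt0// lef_pV2 ?posrE ?mulr_gt0//.
  rewrite expr2 [pi * n]mulrC -!mulrA ler_pM2l// ler_pM2r//.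
  by apply: (le_trans s1); lra.
have b2 : `|dQ x * (2^-1 - d)| <= (n * s ^+ 2)^-1.
  have hd : 0 <= 2^-1 - d by rewrite subr_ge0.
  rewrite normrM (ger0_norm hd); apply: (@le_trans _ _ `|dQ x|).
    by rewrite ler_piMr//; lra.
  rewrite /dQ normrM normrM -[leRHS]mul1r.
  apply: ler_pM => //; first by rewrite -[leRHS]mul1r ler_pM// cos_max.
  have sx0 : 0 < sin (pi * x) by exact: lt_le_trans hs.
  rewrite normfV gtr0_norm ?mulr_gt0 ?exprn_gt0//.
  rewrite lef_pV2 ?posrE ?mulr_gt0 ?exprn_gt0//.
  by rewrite ler_pM2l// ler_pXn2r ?nnegrE ?(ltW s0) ?(ltW sx0).
apply: le_trans (ler_normB _ _) _; apply: le_trans (lerD b1 b2) _.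
have kn : k.+1%:R <= n by rewrite ler_nat mul2n -addnn addn1 ltnS leq_addr.
have -> : (n * s ^+ 2)^-1 + (n * s ^+ 2)^-1 = 2 / s ^+ 2 * n^-1.
  by move: (s) (n) s0 n0 => s' n' s'0 n'0; field; rewrite !gt_eqF.
rewrite ler_pM2l ?divr_gt0 ?exprn_gt0//.
by rewrite lef_pV2 ?posrE.
Qed.

(** * Primitives of trigonometric sums times the Dirichlet kernel *)

(** An integral encoded by a primitive, so that identities are checked by differentiation alone;
    [has_primitive_integral] passes to the Lebesgue integral. *)
Definition has_primitive (R : realType) (f : R -> R) (p q v : R) : Prop :=
  exists2 F : R -> R, (forall t : R, is_derive t 1 F (f t)) & F q - F p = v.

Lemma eq_has_primitive (R : realType) (f g : R -> R) (p q u v : R) :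
  f =1 g -> u = v -> has_primitive f p q u -> has_primitive g p q v.
Proof. by move=> /funext -> ->. Qed.

Lemma has_primitiveD (R : realType) (f g : R -> R) (p q u v : R) :
  has_primitive f p q u -> has_primitive g p q v ->
  has_primitive (fun t => f t + g t) p q (u + v).
Proof.
move=> [F Ff <-] [G Gg <-]; exists (fun t => F t + G t); last by ring.
by move=> t; have := Ff t; have := Gg t => ? ?; exact: is_deriveD.
Qed.

Lemma has_primitive_sum (R : realType) (n : nat) (f : nat -> R -> R)
    (p q : R) (v : nat -> R) :
  (forall i, has_primitive (f i) p q (v i)) ->
  has_primitive (fun t => \sum_(i < n) f i t) p q (\sum_(i < n) v i).
Proof.
move=> fv; elim: n => [|n IH].
  exists (cst 0); last by rewrite big_ord0 subrr.
  by move=> t; rewrite big_ord0; exact: is_derive_cst.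
under eq_fun do rewrite big_ord_recr /=.
by rewrite big_ord_recr /=; exact: has_primitiveD.
Qed.

(* The integral of [cos (w y)] over [-d, d]. *)
Definition cos_integral (R : realType) (d w : R) : R :=
  if w == 0 then 2 * d else 2 * sin (w * d) / w.

Lemma cos_integralN (R : realType) (d w : R) :
  cos_integral d (- w) = cos_integral d w.
Proof.
rewrite /cos_integral oppr_eq0; case: eqP => // _.
by rewrite mulNr sinN invrN !mulrN mulNr opprK.
Qed.

(** The sine is odd about the midpoint [x] of the interval, so only the cosine contributes. *)
Lemma has_primitive_harmonic (R : realType) (a b w x d : R) :
  has_primitive (fun y => a * cos (w * (y - x)) + b * sin (w * (y - x)))
    (x - d) (x + d) (a * cos_integral d w).
Proof.
have xd1 : x + d - x = d by ring.
have xd2 : x - d - x = - d by ring.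
rewrite /cos_integral; case: eqP => [->|/eqP w0].
  exists (fun y => a * y); last by ring.
  move=> t; rewrite mul0r cos0 sin0.
  by apply: is_derive_eq; rewrite /GRing.scale /=; ring.
exists (fun y => a / w * sin (w * (y - x)) - b / w * cos (w * (y - x))).
  move=> t.
  have h : is_derive t 1 (fun y => w * (y - x)) w.
    by apply: is_derive_eq; rewrite /GRing.scale /=; ring.
  apply: is_derive_eq.
  by rewrite /GRing.scale /=; field.
by rewrite xd1 xd2 mulrN sinN cosN; field.
Qed.

(* The indicator of [n <= k] minus the integral of [cos (2 pi n y)] times
   [dirichlet k y] over [-d, d]. *)
Definition localization_weight (R : realType) (d : R) (n k : nat) : R :=
  if (n <= k)%N then sawtooth_rem (k + n) d + sawtooth_rem (k - n) d
  else sawtooth_rem (k + n) d - sawtooth_rem (n - k).-1 d.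

(** A term of the sawtooth series is the integral of one harmonic over [-d, d]; hence sums of such
    integrals telescope into remainders. *)
Lemma sawtooth_remS (R : realType) (k : nat) (d : R) :
  sawtooth_rem k d - sawtooth_rem k.+1 d =
  cos_integral d (2 * pi * k.+1%:R).
Proof.
have p0 : pi != 0 :> R by rewrite gt_eqF ?pi_gt0.
have k0 : k.+1%:R != 0 :> R by rewrite pnatr_eq0.
have w0 : 2 * pi * k.+1%:R != 0 :> R by rewrite !mulf_neq0 ?pnatr_eq0.
rewrite /cos_integral (negbTE w0) /sawtooth_rem big_ord_recr /=.
have cE (c s t : R) : c - s - (c - (s + t)) = t by ring.
rewrite cE.
clear w0; move: (sin _) => s; move: (@pi R) p0 (k.+1%:R) k0 => P P0 K K0.
by field; rewrite K0.
Qed.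

Lemma localization_weight0 (R : realType) (d : R) (n : nat) :
  (n <= 0)%N%:R - localization_weight d n 0 = cos_integral d (2 * pi * n%:R).
Proof.
rewrite /localization_weight; case: n => [|n] /=.
  by rewrite mulr0 /cos_integral eqxx /sawtooth_rem !big_ord0; field.
by rewrite sub0r opprB add0n sawtooth_remS.
Qed.

(** The recursion behind the induction on [k] in [has_primitive_dirichlet]; the Kronecker term is
    the jump of the indicator of [n <= k]. *)
Lemma localization_weightS (R : realType) (d : R) (n k : nat) :
  localization_weight d n k - localization_weight d n k.+1 =
  cos_integral d (2 * pi * (n%:R + k.+1%:R)) +
  cos_integral d (2 * pi * (n%:R - k.+1%:R)) - (n == k.+1)%:R.
Proof.
rewrite -natrD addnS [(n + k)%N]addnC -sawtooth_remS /localization_weight addSn.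
have [nk|nk|->] := ltngtP n k.+1.
- have {nk} [m ->] : exists m, k = (n + m)%N by exists (k - n)%N; lia.
  have -> : n%:R - (n + m).+1%:R = - m.+1%:R :> R.
    by rewrite -addnS natrD; ring.
  rewrite mulrN cos_integralN -sawtooth_remS leq_addr.
  rewrite (subSn (leq_addr _ _)) addKn.
  by rewrite subr0; ring.
- have -> : (n <= k)%N = false by apply/negbTE; rewrite -ltnNge; lia.
  rewrite -natrB; last exact: ltnW.
  have [m mE] : exists m, n = (k.+1 + m.+1)%N.
    by exists (n - k.+2)%N; lia.
  have -> : (n - k.+1 = m.+1)%N by lia.
  have -> : (n - k = m.+2)%N by lia.
  by rewrite -sawtooth_remS /=; ring.
(* Here one frequency is zero, with integral [2 d], and it matches [1 - 2 * sawtooth_rem 0 d]. *)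
- rewrite ltnn subrr mulr0 subnn subSnn /= /cos_integral eqxx.
  by rewrite /sawtooth_rem !big_ord0; field.
Qed.

(** By the product-to-sum formulas, the kernel term of index [k + 1] splits the harmonic [n] into
    the frequencies [n + k + 1] and [n - k - 1]. *)
Lemma has_primitive_dirichlet (R : realType) (a b x d : R) (n k : nat) :
  has_primitive (fun y => (a * cos (2 * pi * n%:R * (y - x)) +
                           b * sin (2 * pi * n%:R * (y - x))) *
                          dirichlet k (y - x))
    (x - d) (x + d) (a * ((n <= k)%N%:R - localization_weight d n k)).
Proof.
elim: k => [|k IH].
  rewrite localization_weight0.
  under eq_fun do rewrite /dirichlet big_ord0 addr0 mulr1.
  exact: has_primitive_harmonic.
set w1 : R := 2 * pi * (n%:R + k.+1%:R).
set w2 : R := 2 * pi * (n%:R - k.+1%:R).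
have -> : (n <= k.+1)%N%:R - localization_weight d n k.+1 =
  ((n <= k)%N%:R - localization_weight d n k) +
    (cos_integral d w1 + cos_integral d w2).
  have -> : (n <= k.+1)%N%:R = (n <= k)%N%:R + (n == k.+1)%N%:R :> R.
    rewrite (leq_eqVlt n) ltnS -natrD; congr (_%:R).
    by case: eqP => [->|_]; rewrite ?ltnn ?addn0.
  rewrite -[localization_weight d n k.+1](subKr (localization_weight d n k)).
  by rewrite localization_weightS; ring.
apply: (eq_has_primitive _ _ (has_primitiveD IH (has_primitiveD
  (has_primitive_harmonic a b w1 x d) (has_primitive_harmonic a b w2 x d))));
  last by rewrite -!mulrDr.
move=> y; rewrite /dirichlet big_ord_recr /=.
have -> : w1 * (y - x) = 2 * pi * n%:R * (y - x) + 2 * pi * k.+1%:R * (y - x).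
  by rewrite /w1; ring.
have -> : w2 * (y - x) = 2 * pi * n%:R * (y - x) - 2 * pi * k.+1%:R * (y - x).
  by rewrite /w2; ring.
by rewrite sinB sinD cosB cosD; ring.
Qed.

Definition trig_sum (R : realType) (A B : nat -> R) (N : nat) (x : R) : R :=
  \sum_(n < N.+1) (A n * cos (2 * pi * n%:R * x) + B n * sin (2 * pi * n%:R * x)).

(** The addition formulas re-expand each harmonic about [x]; the indicator of [n <= k] then
    truncates the sum to [trig_sum A B k x]. *)
Lemma has_primitive_trig_sum (R : realType) (A B : nat -> R) (N k : nat)
    (x d : R) : (k <= N)%N ->
  has_primitive (fun y => trig_sum A B N y * dirichlet k (y - x)) (x - d) (x + d)
    (trig_sum A B k x -
     \sum_(n < N.+1) (A n * cos (2 * pi * n%:R * x) + B n * sin (2 * pi * n%:R * x))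
       * localization_weight d n k).
Proof.
move=> kN.
pose c n : R := cos (2 * pi * n%:R * x).
pose s n : R := sin (2 * pi * n%:R * x).
apply: (eq_has_primitive _ _ (has_primitive_sum N.+1
  (fun n => has_primitive_dirichlet (A n * c n + B n * s n)
              (B n * c n - A n * s n) x d n k))).
  move=> y; rewrite -big_distrl /=; congr (_ * _).
  apply: eq_bigr => n _.
  have -> : 2 * pi * n%:R * y = 2 * pi * n%:R * x + 2 * pi * n%:R * (y - x) by ring.
  by rewrite cosD sinD /c /s; ring.
under eq_bigr do rewrite mulrBr.
rewrite big_split /= sumrN; congr (_ - _).
rewrite /trig_sum (big_ord_widen N.+1 (fun n => A n * c n + B n * s n))//.
rewrite [RHS]big_mkcond /=; apply: eq_bigr => n _.
by rewrite ltnS; case: leqP; rewrite ?mulr1 ?mulr0.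
Qed.

(** * Localization for trigonometric sums *)

(** The successor of the smaller sawtooth index in [localization_weight d n k], hence the
    denominator in its bound; it is positive and comparable to 1 + |n - k|. *)
Definition near_diagonal (n k : nat) : nat :=
  if (n <= k)%N then (k - n).+1 else (n - k)%N.

Lemma near_diagonal_gt0 (n k : nat) : (0 < near_diagonal n k)%N.
Proof. by rewrite /near_diagonal; case: (leqP n k); rewrite ?subn_gt0. Qed.

Lemma localization_weight_bound (R : realType) (d C : R) :
  (forall k, `|sawtooth_rem k d| <= C / k.+1%:R) -> forall n k,
  `|localization_weight d n k| <= 2 * C / (near_diagonal n k)%:R.
Proof.
move=> h n k.
have C0 : 0 <= C.
  by have := le_trans (normr_ge0 _) (h 0%N); rewrite divr1.
have mono (i j : nat) : (0 < i)%N -> (i <= j)%N -> C / j%:R <= C / i%:R.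
  move=> i0 ij; apply: ler_wpM2l => //.
  by rewrite lef_pV2 ?posrE ?ltr0n ?(leq_trans i0)// ler_nat.
rewrite mulr_natl mulrnAl mulr2n /localization_weight /near_diagonal.
case: (leqP n k) => nk.
  apply: le_trans (ler_normD _ _) _; apply: lerD => //.
  by apply: le_trans (h _) _; apply: mono => //; lia.
apply: le_trans (ler_normB _ _) _; apply: lerD.
  by apply: le_trans (h _) _; apply: mono => //; lia.
by apply: le_trans (h _) _; rewrite prednK// subn_gt0.
Qed.

(** Since [1 / m^2 <= 2 / m - 2 / (m + 1)], each side of the diagonal telescopes to at most 2. *)
Lemma sum_inv_sqr_near_diagonal (R : realType) (k N : nat) :
  \sum_(0 <= n < N) ((near_diagonal n k)%:R ^- 2) <= 4 :> R.
Proof.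
have step (m : nat) : (m.+1%:R : R) ^- 2 + 2 / m.+2%:R <= 2 / m.+1%:R.
  set x : R := m.+1%:R.
  have x1 : 1 <= x by rewrite ler1n.
  have -> : m.+2%:R = x + 1 by rewrite natr1.
  rewrite -subr_ge0.
  have -> : 2 / x - (x ^- 2 + 2 / (x + 1)) = (x - 1) / (x ^+ 2 * (x + 1)).
    by field; rewrite !gt_eqF//; lra.
  by apply: divr_ge0; [lra|rewrite mulr_ge0 ?exprn_ge0//; lra].
(* The telescoped majorant: it rises to 2 at [n = k + 1], then from 2 towards 4. *)
pose u (n : nat) : R :=
  if (n <= k.+1)%N then 2 / (k.+2 - n)%:R else 4 - 2 / (n - k)%:R.
suff H : \sum_(0 <= n < N) ((near_diagonal n k)%:R ^- 2) <= u N.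
  apply: le_trans H _; rewrite /u; case: (leqP N k.+1) => h.
    apply: (@le_trans _ _ 2); last by rewrite ler_nat.
    by rewrite ler_pdivrMr ?ltr0n ?subn_gt0// ler_peMr// ler1n subn_gt0.
  by rewrite gerBl divr_ge0.
elim: N => [|N IH].
  by rewrite big_geq// /u /= divr_ge0.
rewrite big_nat_recr//=; apply: le_trans (lerD IH (lexx _)) _.
rewrite /u /near_diagonal.
have [Nk|Nk|->] := ltngtP N k.+1.
- have {}Nk : (N <= k)%N by [].
  rewrite Nk; have [m ->] : exists m, k = (N + m)%N by exists (k - N)%N; lia.
  have -> : ((N + m).+2 - N = m.+2)%N by lia.
  have -> : ((N + m).+2 - N.+1 = m.+1)%N by lia.
  by rewrite addKn addrC; exact: step.
- have -> : (N <= k)%N = false by apply/negbTE; lia.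
  have [m mE] : exists m, (N - k = m.+1)%N by exists (N - k.+1)%N; lia.
  have -> : (N.+1 - k = m.+2)%N by lia.
  rewrite mE.
  move: (step m); move: (_ ^- 2) (2 / m.+1%:R) (2 / m.+2%:R) => p q r; lra.
- have -> : (k.+2 - k = 2)%N by lia.
  by rewrite ltnn !subSnn; lra.
Qed.

(** Once a partial sum is within [e] of the supremum, later terms cannot add more than [e]. *)
Lemma bounded_series_tail (R : realType) (b : nat -> R) (S e : R) :
  (forall n, 0 <= b n) -> (forall N, \sum_(0 <= n < N) b n <= S) -> 0 < e ->
  exists K, forall N, \sum_(K <= n < N) b n <= e.
Proof.
move=> b0 bS e0.
pose E := range (fun N => \sum_(0 <= n < N) b n).
have hE : has_sup E.
  split; first by exists (\sum_(0 <= n < 0) b n); exists 0%N.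
  by exists S => _ [N _ <-].
have [_ [K _ <-] hK] := sup_adherent e0 hE.
exists K => N; have [NK|KN] := leqP N K; first by rewrite big_geq ?ltW.
have : \sum_(0 <= n < N) b n <= sup E.
  by apply: ub_le_sup; [exact: hE.2|exists N].
rewrite (big_cat_nat (n := K))//=; last exact: ltnW.
by move: hK; lra.
Qed.

Lemma near_diagonal_sum_small (R : realType) (a : nat -> R) (S e : R) :
  (forall n, 0 <= a n) -> (forall N, \sum_(0 <= n < N) a n ^+ 2 <= S) ->
  0 < e -> exists k0, forall k N, (k0 <= k)%N ->
    \sum_(0 <= n < N) a n / (near_diagonal n k)%:R <= e.
Proof.
move=> a0 aS e0.
(* Below [K] the denominators tend to infinity with [k]; beyond [K] use
   [a n / m <= a n ^ 2 / t + t / m ^ 2]. *)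
pose t := e / 6; have t0 : 0 < t by rewrite divr_gt0.
have [K hK] := bounded_series_tail (fun n => sqr_ge0 (a n)) aS (exprn_gt0 2 t0).
pose s := \sum_(0 <= n < K) a n.
have s0 : 0 <= s by exact: sumr_ge0.
(* For [k >= K + j] the denominators below [K] are at least [j + 1], which brings that part under
   [s / (j + 1) <= t]. *)
pose j := Num.truncn (s / t).
have hj : s / t < j.+1%:R by exact: truncnS_gt.
exists (K + j)%N => k N kK.
apply: (@le_trans _ _ (\sum_(0 <= n < K + N) a n / (near_diagonal n k)%:R)).
  rewrite [leRHS](big_cat_nat (n := N))//= ?leq_addl// lerDl.
  by apply: sumr_ge0 => n _; rewrite divr_ge0.
rewrite (big_cat_nat (n := K))//= ?leq_addr//.
(* The terms below [K] get [t]; beyond [K], the squares get [t] and the inverse squares [4 t]. *)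
have -> : e = t + 5 * t by rewrite /t; lra.
apply: lerD.
  apply: (@le_trans _ _ (s / j.+1%:R)); last first.
    by rewrite ler_pdivrMr// mulrC -ler_pdivrMr// ltW.
  rewrite /s mulr_suml big_seq [leRHS]big_seq; apply: ler_sum => n.
  rewrite mem_index_iota => /andP[_ nK]; apply: ler_wpM2l => //.
  rewrite lef_pV2 ?posrE ?ltr0n ?near_diagonal_gt0// ler_nat.
  by rewrite /near_diagonal; case: (leqP n k); lia.
apply: (@le_trans _ _ (\sum_(K <= n < K + N)
    (a n ^+ 2 / t + t * (near_diagonal n k)%:R ^- 2))).
  apply: ler_sum => n _.
  move: (a n) (a0 n) => x x0; set y := _^-1.
  have -> : (near_diagonal n k)%:R ^- 2 = y ^+ 2 by rewrite exprVn.
  have : 0 <= t^-1 * (x - t * y) ^+ 2 + x * y.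
    have y0 : 0 <= y by rewrite /y invr_ge0.
    apply: addr_ge0; last exact: mulr_ge0.
    by apply: mulr_ge0; [rewrite invr_ge0 ltW|exact: sqr_ge0].
  suff -> : t^-1 * (x - t * y) ^+ 2 = x ^+ 2 / t + t * y ^+ 2 - 2 * (x * y) by lra.
  by field; rewrite gt_eqF.
rewrite big_split /= -mulr_suml -mulr_sumr.
have h1 : (\sum_(K <= n < K + N) a n ^+ 2) / t <= t.
  by rewrite ler_pdivrMr// -expr2.
have h2 : t * \sum_(K <= n < K + N) (near_diagonal n k)%:R ^- 2 <= t * 4.
  rewrite ler_pM2l//; apply: le_trans (sum_inv_sqr_near_diagonal R k (K + N)).
  rewrite [leRHS](big_cat_nat (n := K))//= ?leq_addr// lerDr.
  by apply: sumr_ge0 => n _; rewrite invr_ge0 exprn_ge0.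
by lra.
Qed.

(** In the smallness hypothesis [N] may depend on [k] and [x]; the error bound holds for every [N],
    so [k0] is still uniform in [x]. *)
Lemma trig_sum_uniformly_small (R : realType) (A B a : nat -> R) (S d : R)
    (X : set R) :
  (forall n, `|A n| + `|B n| <= a n) ->
  (forall N, \sum_(0 <= n < N) a n ^+ 2 <= S) ->
  0 < d <= 2^-1 ->
  (forall (x : R) (k : nat) (e : R), X x -> 0 < e ->
     exists2 N, (k <= N)%N & forall v,
     has_primitive (fun y => trig_sum A B N y * dirichlet k (y - x))
       (x - d) (x + d) v -> `|v| <= e) ->
  forall e : R, 0 < e -> exists k0 : nat, forall (k : nat) (x : R),
    (k0 <= k)%N -> X x -> `|trig_sum A B k x| <= e.
Proof.
move=> ABa aS d12 small e e0.
have [C C0 hC] := sawtooth_rem_bound d12.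
have a0 n : 0 <= a n by apply: le_trans (ABa n); exact: addr_ge0.
have t0 : 0 < e / 2 / (2 * C) by rewrite divr_gt0 ?divr_gt0 ?mulr_gt0.
have [k0 hk0] := near_diagonal_sum_small a0 aS t0.
exists k0 => k x k0k Xx.
have e20 : 0 < e / 2 by rewrite divr_gt0.
have [N kN hN] := small x k (e / 2) Xx e20.
set E := \sum_(n < N.+1) (A n * cos (2 * pi * n%:R * x) +
           B n * sin (2 * pi * n%:R * x)) * localization_weight d n k.
have h1 : `|trig_sum A B k x - E| <= e / 2.
  by apply: hN; exact: has_primitive_trig_sum.
suff h2 : `|E| <= e / 2.
  rewrite -[trig_sum A B k x](subrK E) (le_trans (ler_normD _ _))//.
  by rewrite [leRHS](splitr e) lerD.
apply: le_trans (ler_norm_sum _ _ _) _.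
apply: (@le_trans _ _ (\sum_(0 <= n < N.+1) a n / (near_diagonal n k)%:R * (2 * C))).
  rewrite big_mkord; apply: ler_sum => n _.
  rewrite normrM [leRHS]mulrAC -[leRHS]mulrA; apply: ler_pM => //.
    apply: le_trans (ABa n); apply: le_trans (ler_normD _ _) _.
    by apply: lerD; rewrite normrM ler_piMr ?cos_max ?sin_max.
  exact: localization_weight_bound.
by rewrite -mulr_suml -ler_pdivlMr ?mulr_gt0//; exact: hk0.
Qed.

Lemma norm_dirichlet_le (R : realType) (k : nat) (t : R) :
  `|dirichlet k t| <= (2 * k + 1)%:R.
Proof.
rewrite /dirichlet addnC natrD; apply: le_trans (ler_normD _ _) _.
rewrite normr1 lerD2l; apply: le_trans (ler_norm_sum _ _ _) _.
apply: (@le_trans _ _ (\sum_(j < k) 2)).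
  by apply: ler_sum => j _; rewrite normrM ger0_norm// ler_piMr ?cos_max.
by rewrite sumr_const card_ord natrM mulr_natr.
Qed.

(** * Integrals of partial sums *)

Lemma continuous_cos_scale (R : realType) (w : R) :
  continuous (fun y : R => cos (w * y)).
Proof.
move=> y; apply: differentiable_continuous; apply/derivable1_diffP.
by case: (is_derive_cos_scale w y).
Qed.

Lemma continuous_sin_scale (R : realType) (w : R) :
  continuous (fun y : R => sin (w * y)).
Proof.
move=> y; apply: differentiable_continuous; apply/derivable1_diffP.
by case: (is_derive_sin_scale w y).
Qed.

Lemma continuous_trig_sum (R : realType) (A B : nat -> R) (N : nat) :
  continuous (trig_sum A B N).
Proof.
apply: continuous_big; first exact: add_continuous.
move=> n _ y; apply: cvgD; apply: cvgM; try exact: cst_continuous.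
  exact: continuous_cos_scale.
exact: continuous_sin_scale.
Qed.

Lemma continuous_dirichlet (R : realType) (k : nat) : continuous (@dirichlet R k).
Proof.
move=> y; apply: cvgD; first exact: cst_continuous.
apply: continuous_big; first exact: add_continuous.
move=> n _ z; apply: cvgM; first exact: cst_continuous.
exact: continuous_cos_scale.
Qed.

Lemma has_primitive_integral (R : realType) (f : R -> R) (p q v : R) : p < q ->
  continuous f -> has_primitive f p q v ->
  (\int[@lebesgue_measure R]_(y in `[p, q]) (f y)%:E)%E = v%:E.
Proof.
move=> pq cf [F Ff <-].
have cF : continuous F.
  move=> y; apply: differentiable_continuous; apply/derivable1_diffP.
  by case: (Ff y).
rewrite (continuous_FTC2 (F := F) pq)//.
- exact: continuous_subspaceT.
- split.
  + by move=> y _; case: (Ff y).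
  + exact/cvg_at_right_filter/cF.
  + exact/cvg_at_left_filter/cF.
- by move=> y _; rewrite derive1E; have := Ff y => ?; rewrite derive_val.
Qed.

(** A quadratic form of Cauchy-Schwarz, [|f h| <= t + c f^2]; the threshold [s] depends on [h] only
    through [K] and not on [f]. *)
Lemma has_primitive_small (R : realType) (p q K e : R) : p < q -> 0 < e ->
  exists2 s : R, 0 < s & forall (f h : R -> R) (v : R),
    continuous f -> continuous h -> (forall y, `|h y| <= K) ->
    (\int[@lebesgue_measure R]_(y in `[p, q]) (f y ^+ 2)%:E <= s%:E)%E ->
    has_primitive (fun y => f y * h y) p q v -> `|v| <= e.
Proof.
move=> pq e0.
have pq0 : 0 < q - p by rewrite subr_gt0.
pose t := e / 2 / (q - p).
have e20 : 0 < e / 2 by rewrite divr_gt0.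
have t0 : 0 < t by exact: divr_gt0.
(* The [+ 1] keeps [c] positive when [K = 0], so that one can divide by it. *)
pose c := (K ^+ 2 + 1) / t.
have c0 : 0 < c by rewrite divr_gt0//; have := sqr_ge0 K; lra.
exists (e / 2 / c); first exact: divr_gt0.
move=> f h v cf ch hK fs hv.
have cfh : continuous (fun y => f y * h y).
  by move=> y; apply: cvgM; [exact: cf|exact: ch].
have mI : measurable (`[p, q] : set (measurableTypeR R)) by exact: measurable_itv.
have mfh : measurable_fun (`[p, q] : set (measurableTypeR R))
    (EFin \o (fun y => f y * h y)).
  apply/measurable_EFinP; apply: measurable_funTS.
  exact: continuous_measurable_fun.
have mf2 : measurable_fun (`[p, q] : set (measurableTypeR R))
    (EFin \o (fun y => f y ^+ 2)).
  apply/measurable_EFinP; apply: measurable_funX; apply: measurable_funTS.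
  exact: continuous_measurable_fun.
rewrite -lee_fin -[(`|v|)%:E]/(`|v%:E|)%E -(has_primitive_integral pq cfh hv).
apply: le_trans (le_abse_integral _ mI mfh) _.
apply: (@le_trans _ _ (\int[@lebesgue_measure R]_(y in `[p, q])
    (t%:E + c%:E * (f y ^+ 2)%:E))%E).
  apply: ge0_le_integral => //.
  - exact: measurableT_comp.
  - by apply: emeasurable_funD => //; exact: measurable_funeM.
  - move=> y _; rewrite abse_EFin -EFinM -EFinD lee_fin normrM.
    apply: (@le_trans _ _ (`|f y| * K)); first by rewrite ler_wpM2l.
    have fE : f y ^+ 2 = `|f y| ^+ 2 by rewrite real_normK ?num_real.
    rewrite fE; move: (`|f y|) (normr_ge0 (f y)) => z z0.
    have ti0 : 0 < t^-1 by rewrite invr_gt0.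
    have -> : t + c * z ^+ 2 = t^-1 * ((t - z * K) ^+ 2 + z ^+ 2 + 2 * t * (z * K)).
      by rewrite /c; field; rewrite gt_eqF.
    rewrite mulrDr; have -> : t^-1 * (2 * t * (z * K)) = 2 * (z * K).
      by field; rewrite gt_eqF.
    have zK : 0 <= z * K by rewrite mulr_ge0// (le_trans _ (hK p)).
    have : 0 <= t^-1 * ((t - z * K) ^+ 2 + z ^+ 2).
      by rewrite mulr_ge0 ?addr_ge0 ?sqr_ge0// ltW.
    by lra.
rewrite ge0_integralD//.
- rewrite integral_cst// ge0_integralZl//; last by rewrite lee_fin ltW.
    have lI : @lebesgue_measure R `[p, q] = (q - p)%:E.
      by rewrite lebesgue_measure_itv /= lte_fin pq -EFinB.
    have -> : e = t * (q - p) + c * (e / 2 / c).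
      have cK : c * (e / 2 / c) = e / 2 by rewrite mulrC divfK// gt_eqF.
      by rewrite cK /t divfK ?gt_eqF// -splitr.
    rewrite EFinD; apply: leeD; last by rewrite [leRHS]EFinM lee_pmul2l.
    by rewrite [leRHS]EFinM; apply: lee_wpmul2l;
      [rewrite lee_fin ltW|rewrite le_eqVlt; apply/orP; left; exact/eqP].
  by move=> y _; rewrite lee_fin sqr_ge0.
- by move=> y _; rewrite lee_fin ltW.
- by move=> y _; rewrite mule_ge0 ?lee_fin ?sqr_ge0// ltW.
- exact: measurable_funeM.
Qed.

(** * Comparison of measures and L^2 convergence *)

(** The comparison holds only inside [D]; restricting both measures to [D] makes it global, and the
    integral is monotone in the measure. *)
Lemma ge0_le_integral_mscale d (T : measurableType d) (R : realType)
    (mu nu : {measure set T -> \bar R}) (m : R) (D : set T) (f : T -> \bar R) :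
  0 < m -> measurable D ->
  (forall A, measurable A -> A `<=` D -> (m%:E * mu A <= nu A)%E) ->
  (forall x, (0 <= f x)%E) -> measurable_fun [set: T] f ->
  (m%:E * \int[mu]_(x in D) f x <= \int[nu]_(x in D) f x)%E.
Proof.
move=> m0 mD munu f0 mf.
pose r : {nonneg R} := NngNum (ltW m0).
pose mr : {measure set T -> \bar R} := mscale r (mrestr mu mD).
pose nr : {measure set T -> \bar R} := mrestr nu mD.
have mrnr A : measurable A -> (mr A <= nr A)%E.
  by move=> mA; apply: munu; [exact: measurableI|exact: subIsetr].
have := ge0_le_measure_integral mrnr mD f0 mf.
have -> : (\int[nr]_(x in D) f x = \int[nu]_(x in D) f x)%E.
  apply: eq_measure_integral => A mA AD.
  by transitivity (nu (A `&` D)) => //; rewrite setIidl.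
rewrite /mr ge0_integral_mscale//; last exact: measurable_funS mf.
suff -> : (\int[mrestr mu mD]_(x in D) f x = \int[mu]_(x in D) f x)%E by [].
apply: eq_measure_integral => A mA AD.
by transitivity (mu (A `&` D)) => //; rewrite setIidl.
Qed.

(** The power 1/2 is monotone, so an integral of at least [s] would force a norm of at least the
    square root of [s]. *)
Lemma cvg_L2_integral_small (R : realType)
    (mu : {measure set (measurableTypeR R) -> \bar R})
    (u : nat -> R -> R[i]) (f : R -> R[i]) : cvg_L2 mu u f ->
  forall s : R, 0 < s -> exists N0, forall N, (N0 <= N)%N ->
  (\int[mu]_x ((Normc.normc (u N x - f x)) ^+ 2)%:E < s%:E)%E.
Proof.
move=> uf s s0.
have s20 : 0 < s `^ 2^-1 by rewrite powR_gt0.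
have : \forall N \near \oo, (Lnorm mu 2%:E
    (fun x : R => (Normc.normc (u N x - f x))%:E) < (s `^ 2^-1)%:E)%E.
  have s20E : (0 < (s `^ 2^-1)%:E)%E by rewrite lte_fin.
  exact: (uf _ (open_ereal_lt' s20E)).
move=> [N0 _ hN0]; exists N0 => N /hN0 /=.
rewrite unlock /= => h; rewrite ltNge; apply/negP => hs; move: h.
apply/negP; rewrite -leNgt.
rewrite -poweR_EFin; apply: gt0_ler_poweR => //.
- by rewrite in_itv /= lee_fin ltW ?leey.
- by rewrite in_itv /= integral_ge0 ?leey// => x _; exact: poweR_ge0.
- rewrite (le_trans hs)// le_eqVlt; apply/orP; left; apply/eqP.
  apply: eq_integral => x _; set z := Normc.normc _.
  have z0 : 0 <= z by rewrite /z; case: (u N x - f x) => p q; exact: sqrtr_ge0.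
  by rewrite ger0_norm// -powR_mulrn.
Qed.

(** * Real form of the Fourier partial sums *)

Lemma normc_sqrE (R : realType) (x y : R) :
  Normc.normc (x +i* y) ^+ 2 = x ^+ 2 + y ^+ 2.
Proof. by rewrite /= sqr_sqrtr// addr_ge0 ?sqr_ge0. Qed.

(** By injectivity the partial sum runs over a finite set of integers; [e] will be [n] and [- n]. *)
Lemma square_summable_bounded (R : realType) (c : int -> R[i]) (e : nat -> int) :
  square_summable c -> injective e ->
  exists S : R, forall N, \sum_(0 <= n < N) Normc.normc (c (e n)) ^+ 2 <= S.
Proof.
move=> sc ie.
set f := fun n : int => (Normc.normc (c n) ^+ 2)%:E.
have f0 n : (0 <= f n)%E by rewrite lee_fin sqr_ge0.
have sfin : (\esum_(n in [set: int]) f n < +oo)%E.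
  apply: le_lt_trans sc; apply: le_esum => n _; exact: lee_abs.
have sfinE : (\esum_(n in [set: int]) f n \is a fin_num)%E.
  by rewrite ge0_fin_numE// esum_ge0.
exists (fine (\esum_(n in [set: int]) f n)) => N.
rewrite -lee_fin fineK// -sumEFin; apply: esum_ge.
exists (e @` `I_N); first by split => //; exact: finite_image.
rewrite fsbig_image//=; last by move=> i j _ _; exact: ie.
by rewrite big_mkord -fsbig_ord.
Qed.

(** The frequencies [n] and [- n] are paired; the factor [(n != 0)] keeps [c 0] from being counted
    twice. *)
Definition re_cos_coeff (R : realType) (c : int -> R[i]) (n : nat) : R :=
  complex.Re (c n%:Z) + (n != 0)%:R * complex.Re (c (- n%:Z)).

Definition re_sin_coeff (R : realType) (c : int -> R[i]) (n : nat) : R :=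
  - complex.Im (c n%:Z) + (n != 0)%:R * complex.Im (c (- n%:Z)).

Definition im_cos_coeff (R : realType) (c : int -> R[i]) (n : nat) : R :=
  complex.Im (c n%:Z) + (n != 0)%:R * complex.Im (c (- n%:Z)).

Definition im_sin_coeff (R : realType) (c : int -> R[i]) (n : nat) : R :=
  complex.Re (c n%:Z) - (n != 0)%:R * complex.Re (c (- n%:Z)).

Lemma fourier_partial_sumS (R : realType) (c : int -> R[i]) (N : nat) (x : R) :
  fourier_partial_sum c N.+1 x =
  c (- N.+1%:Z) * fourier_exp (- N.+1%:Z) x + fourier_partial_sum c N x +
  c N.+1%:Z * fourier_exp N.+1%:Z x.
Proof.
rewrite /fourier_partial_sum mulnS addSn add1n big_ord_recl big_ord_recr /=.
rewrite sub0r addrA; congr (_ + _ + _ * _).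
- apply: eq_bigr => i _; rewrite /bump /= add1n.
  by rewrite (_ : i.+1%:Z - N.+1%:Z = i%:Z - N%:Z); last by lia.
- by rewrite /bump; congr c; lia.
- by rewrite /bump; congr (fourier_exp _ _); lia.
Qed.

Lemma fourier_partial_sumE (R : realType) (c : int -> R[i]) (N : nat) (x : R) :
  fourier_partial_sum c N x =
  trig_sum (re_cos_coeff c) (re_sin_coeff c) N x +i*
  trig_sum (im_cos_coeff c) (im_sin_coeff c) N x.
Proof.
elim: N => [|N IH].
  rewrite /fourier_partial_sum /trig_sum !big_ord_recl !big_ord0 /=.
  rewrite /fourier_exp !mulr0 !mul0r cos0 sin0.
  rewrite /re_cos_coeff /im_cos_coeff /= subr0.
  case: (c 0) => p q; rewrite mul0r /=.
  by congr (_ +i* _); ring.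
rewrite fourier_partial_sumS IH /trig_sum [in RHS]big_ord_recr /=.
rewrite [X in _ = _ +i* X]big_ord_recr /=.
rewrite /fourier_exp /re_cos_coeff /re_sin_coeff /im_cos_coeff /im_sin_coeff.
have -> : (- N.+1%:Z)%:~R = - N.+1%:R :> R by rewrite mulrNz.
have -> : N.+1%:Z%:~R = N.+1%:R :> R by [].
rewrite mulrN mulNr cosN sinN.
case: (c N.+1%:Z) (c (- N.+1%:Z)) => p q [p' q'] /=.
by congr (_ +i* _); ring.
Qed.

Lemma norm_re_coeff_le (R : realType) (c : int -> R[i]) (n : nat) :
  `|re_cos_coeff c n| + `|re_sin_coeff c n| <=
  2 * (Normc.normc (c n%:Z) + Normc.normc (c (- n%:Z))).
Proof.
have normc_re (z : R[i]) : `|complex.Re z| <= Normc.normc z.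
  case: z => p q /=; rewrite -sqrtr_sqr ler_wsqrtr// lerDl; exact: sqr_ge0.
have normc_im (z : R[i]) : `|complex.Im z| <= Normc.normc z.
  case: z => p q /=; rewrite -sqrtr_sqr ler_wsqrtr// lerDr; exact: sqr_ge0.
have sgn z : `|(n != 0)%:R * z| <= `|z| :> R.
  by case: eqP => _; rewrite ?mul0r ?mul1r ?normr0.
have h1 := ler_normD (complex.Re (c n%:Z)) ((n != 0)%:R * complex.Re (c (- n%:Z))).
have h2 := ler_normD (- complex.Im (c n%:Z)) ((n != 0)%:R * complex.Im (c (- n%:Z))).
rewrite normrN in h2.
have h3 := sgn (complex.Re (c (- n%:Z))).
have h4 := sgn (complex.Im (c (- n%:Z))).
have h5 := normc_re (c n%:Z).
have h6 := normc_re (c (- n%:Z)).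
have h7 := normc_im (c n%:Z).
have h8 := normc_im (c (- n%:Z)).
rewrite /re_cos_coeff /re_sin_coeff; lra.
Qed.

Lemma re_coeff_bounded (R : realType) (c : int -> R[i]) : square_summable c ->
  exists S : R, forall N, \sum_(0 <= n < N)
    (2 * (Normc.normc (c n%:Z) + Normc.normc (c (- n%:Z)))) ^+ 2 <= S.
Proof.
move=> sc.
have [S1 h1] := @square_summable_bounded R c Posz sc ltac:(by move=> i j []).
have [S2 h2] := @square_summable_bounded R c (fun n => - n%:Z) sc
  ltac:(by move=> i j /oppr_inj []).
(* From [(2 (p + q))^2 <= 8 p^2 + 8 q^2]. *)
exists (8 * S1 + 8 * S2) => N.
apply: le_trans (lerD (ler_wpM2l _ (h1 N)) (ler_wpM2l _ (h2 N))) => //.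
rewrite !mulr_sumr -big_split /=; apply: ler_sum => n _.
move: (Normc.normc _) (Normc.normc _) => p q.
by have := sqr_ge0 (p - q); nra.
Qed.

(** * Lower bound for mu on (c, d) and the contradiction *)

(** [mu A] is at least [mu_a A], the integral over [A] of [g], which is at least [m] almost
    everywhere there. *)
Lemma mass_ge_lebesgue (R : realType)
    (mu mu_a mu_s : {measure set (measurableTypeR R) -> \bar R})
    (g : R -> R) (m M c d : R) (A : set (measurableTypeR R)) :
  (forall A : set (measurableTypeR R), measurable A ->
    mu A = (mu_a A + mu_s A)%E) ->
  is_RN_derivative mu_a g -> 0 < m ->
  {ae @lebesgue_measure R, forall x : R, pos_support g x -> m <= g x <= M} ->
  `]c, d[ `<=` pos_support g -> measurable A -> A `<=` `]c, d[ ->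
  (m%:E * @lebesgue_measure R A <= mu A)%E.
Proof.
move=> hdec [mg g0 gint] m0 hae cdg mA Acd.
have A01 : A `<=` `[0, 1[.
  by move=> x /Acd /cdg /andP[].
rewrite hdec//; apply: (@le_trans _ _ (mu_a A)); last exact: leeDl.
rewrite gint// -integral_cst//.
apply: ae_ge0_le_integral => //.
- by move=> x _; rewrite lee_fin ltW.
- by move=> x /A01 x01; rewrite lee_fin g0.
- by apply/measurable_EFinP; exact: measurable_funS mg.
- case: hae => N [mN N0 hN]; exists N; split => //.
  apply: subset_trans hN => x; apply: contra_not => hx Ax; rewrite lee_fin.
  by have /andP[] := hx (cdg _ (Acd _ Ax)).
Qed.

Lemma normc_sqr_subr_indic (R : realType) (c : int -> R[i]) (N : nat) (x : R)
    (B : set R) :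
  Normc.normc (fourier_partial_sum c N x - (\1_B x)%:C) ^+ 2 =
  (trig_sum (re_cos_coeff c) (re_sin_coeff c) N x - \1_B x) ^+ 2 +
  trig_sum (im_cos_coeff c) (im_sin_coeff c) N x ^+ 2.
Proof.
rewrite fourier_partial_sumE -normc_sqrE.
by congr (Normc.normc _ ^+ 2); rewrite -[LHS]/(_ +i* _) subr0.
Qed.

Lemma measurable_sqr_sum_subr_indic (R : realType) (A B A' B' : nat -> R) (N : nat)
    (E : set (measurableTypeR R)) : measurable E ->
  measurable_fun [set: measurableTypeR R]
    (fun x => ((trig_sum A B N x - \1_E x) ^+ 2 + trig_sum A' B' N x ^+ 2)%:E).
Proof.
move=> mE; apply/measurable_EFinP; apply: measurable_funD.
  apply: measurable_funX; apply: measurable_funB.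
    exact: (continuous_measurable_fun (@continuous_trig_sum _ _ _ _)).
  exact: measurable_indic.
by apply: measurable_funX;
  exact: (continuous_measurable_fun (@continuous_trig_sum _ _ _ _)).
Qed.

Theorem theorem3p11 (R : realType)
    (mu : {finite_measure set (measurableTypeR R) -> \bar R})
    (mu_a mu_s : {measure set (measurableTypeR R) -> \bar R})
    (g : R -> R) (c d a b : R) (B : set (measurableTypeR R))
    (hmu : carried_by_unit mu)
    (hdec : forall A : set (measurableTypeR R), measurable A ->
      mu A = (mu_a A + mu_s A)%E)
    (hs : mutually_singular mu_s (@lebesgue_measure R))
    (hac : mu_a `<< @lebesgue_measure R)
    (hg : is_RN_derivative mu_a g)
    (hbd : bounded_on_support g)
    (hB : measurable B)
    (hB0 : lebesgue_measure B = 0%E)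
    (hBpos : (0 < mu B)%E)
    (hBab : B `<=` `[a, b])
    (habcd : `[a, b] `<=` `]c, d[)
    (hcdg : `]c, d[ `<=` pos_support g) :
  ~ exists cn : int -> R[i],
      square_summable cn /\
      cvg_L2 mu (fourier_partial_sum cn) (fun x : R => (\1_B x)%:C).
Proof.
move=> [cn [sq cvg]].
have [m [M [m0 mM hae]]] := hbd.
(* A point of [B] shows that [a, b] is nonempty, whence [c < a] and [b < d]. *)
have [x0 Bx0] : exists x, B x.
  apply: contrapT => /forallNP h; move: hBpos.
  suff -> : B = set0 by rewrite measure0 ltxx.
  by apply/seteqP; split => // x /h.
have ab : a <= b by move/hBab: Bx0; rewrite /= in_itv /= => /andP[/le_trans]; exact.
have ca : c < a.
  by have := habcd a; rewrite /= !in_itv /= lexx ab => /(_ isT) /andP[].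
have bd : b < d.
  by have := habcd b; rewrite /= !in_itv /= lexx ab => /(_ isT) /andP[].
pose A := re_cos_coeff cn; pose A1 := re_sin_coeff cn.
pose T N x := trig_sum A A1 N x.
pose G N x := (T N x - \1_B x) ^+ 2 +
  trig_sum (im_cos_coeff cn) (im_sin_coeff cn) N x ^+ 2.
have G0 N x : (0 <= (G N x)%:E)%E by rewrite lee_fin addr_ge0 ?sqr_ge0.
have mG N : measurable_fun [set: measurableTypeR R] (fun x => (G N x)%:E).
  exact: measurable_sqr_sum_subr_indic.
have Gsmall (s : R) : 0 < s -> exists N0, forall N, (N0 <= N)%N ->
    (\int[mu]_x (G N x)%:E < s%:E)%E.
  move=> s0; have [N0 hN0] := cvg_L2_integral_small cvg s0.
  exists N0 => N /hN0; apply: le_lt_trans; rewrite le_eqVlt; apply/orP; left.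
  by apply/eqP; apply: eq_integral => x _; rewrite normc_sqr_subr_indic.
have mcd : measurable (`]c, d[ : set (measurableTypeR R)) by exact: measurable_itv.
have mcdB : measurable ((`]c, d[ : set (measurableTypeR R)) `\` B).
  exact: measurableD.
have mT2 N : measurable_fun [set: measurableTypeR R] (fun x => (T N x ^+ 2)%:E).
  apply/measurable_EFinP; apply: measurable_funX.
  exact: (continuous_measurable_fun (@continuous_trig_sum _ _ _ _)).
have T20 N x : (0 <= (T N x ^+ 2)%:E)%E by rewrite lee_fin sqr_ge0.
have Tsmall (s : R) (k : nat) : 0 < s -> exists2 N, (k <= N)%N &
    (\int[@lebesgue_measure R]_(x in `]c, d[) (T N x ^+ 2)%:E <= s%:E)%E.
  move=> s0; have ms0 : 0 < m * s by exact: mulr_gt0.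
  have [N0 hN0] := Gsmall _ ms0.
  exists (maxn k N0); first exact: leq_maxl.
  set N := maxn _ _.
  (* The Lebesgue-null [B] is removed first: off [B] the indicator vanishes and [G N] dominates
     [T N ^+ 2]. *)
  rewrite (@ge0_negligible_integral _ _ _ _ _ B)//; last exact: measurable_funTS.
  rewrite -(@lee_pmul2l _ m%:E)// -EFinM.
  apply: le_trans (ltW (hN0 N (leq_maxr _ _))).
  apply: (@le_trans _ _ (\int[mu]_(x in `]c, d[ `\` B) (T N x ^+ 2)%:E)%E).
    apply: ge0_le_integral_mscale => // E mE EcdB.
    apply: (mass_ge_lebesgue hdec hg m0 hae hcdg) => //.
    by apply: (subset_trans EcdB); exact: subDsetl.
  apply: (@le_trans _ _ (\int[mu]_(x in `]c, d[ `\` B) (G N x)%:E)%E).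
    apply: ge0_le_integral => //; [exact: measurable_funTS|exact: measurable_funTS|].
    move=> x [_ nBx]; rewrite lee_fin /G indicE memNset//= subr0 lerDl.
    exact: sqr_ge0.
  by apply: ge0_subset_integral.
(* For [x] in [a, b] this keeps [x - e, x + e] inside (c, d); the cap 1/2 is the range of
   [sawtooth_rem_bound]. *)
pose e := Num.min (Num.min ((a - c) / 2) ((d - b) / 2)) 2^-1.
have e1 : e <= (a - c) / 2 by rewrite /e !ge_min lexx.
have e2 : e <= (d - b) / 2 by rewrite /e !ge_min lexx orbT.
have e3 : e <= 2^-1 by rewrite /e !ge_min lexx !orbT.
have e0 : 0 < e.
  by rewrite /e !lt_min !divr_gt0 ?subr_gt0//= invr_gt0.
have [S hS] := re_coeff_bounded sq.
have e012 : 0 < e <= 2^-1 by rewrite e0.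
have h12 : 0 < 2^-1 :> R by rewrite invr_gt0.
have h14 : 0 < 4^-1 :> R by rewrite invr_gt0.
have [|k0 hk0] := trig_sum_uniformly_small (norm_re_coeff_le cn) hS e012
  (X := `[a, b]) _ h12.
  move=> x k t; rewrite /= in_itv /= => /andP[ax xb] t0.
  have xe : x - e < x + e by lra.
  (* With [k] fixed the kernel is bounded by [2 k + 1]; only then is [N] chosen. *)
  have [s s0 hst] := has_primitive_small (2 * k + 1)%:R xe t0.
  have [N kN hN] := Tsmall s k s0.
  exists N => // v; apply: hst.
  - exact: continuous_trig_sum.
  - have cs : continuous (fun y : R => y - x).
      by move=> y; apply: cvgB; [exact: cvg_id|exact: cvg_cst].
    by move=> y; exact: (continuous_comp (cs y) (@continuous_dirichlet R k _)).
  - by move=> y; exact: norm_dirichlet_le.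
  - apply: le_trans hN; apply: ge0_subset_integral => //.
    + exact: measurable_funTS.
    + by move=> y /=; rewrite !in_itv /= => /andP[? ?]; apply/andP; split; lra.
have muBfin : mu B \is a fin_num by exact: fin_num_measure.
have r0 : 0 < fine (mu B) by rewrite fine_gt0// hBpos ltey_eq muBfin.
(* On [B], [|T N x| <= 1/2] gives [(T N x - 1)^2 >= 1/4], so the integral of [G N] is at least a
   quarter of [mu B], which is positive and finite. *)
have [N0 hN0] := Gsmall (4^-1 * fine (mu B)) (mulr_gt0 h14 r0).
set N := maxn k0 N0.
have := hN0 N (leq_maxr _ _); rewrite ltNge => /negP; apply.
rewrite EFinM fineK// -integral_cst//.
apply: (@le_trans _ _ (\int[mu]_(x in B) (G N x)%:E)%E); last first.
  by apply: ge0_subset_integral.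
apply: ge0_le_integral => //.
- by move=> x _; rewrite lee_fin ltW.
- exact: measurable_funTS.
move=> x Bx; rewrite lee_fin /G indicE mem_set//=.
have := hk0 N x (leq_maxl _ _) (hBab _ Bx); rewrite -/A -/A1 -/(T N x).
rewrite ler_norml => /andP[h1 h2].
apply: (@le_trans _ _ ((T N x - 1) ^+ 2)); last by rewrite lerDl sqr_ge0.
by move: (T N x) h1 h2 => z h1 h2; nra.
Qed.
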